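(* Let $\Delta_1,L,\sigma>0$, $p\in(1,2]$, and $0<\varepsilon<\min\{\frac{\sigma}{4},\frac{\sqrt{\Delta_1L}}{2}\}$. Then for all integers $m,n\ge2$, $$\mathfrak m^{\mathrm{rand}}_\varepsilon\big(\|\cdot\|_{S_1},\Delta_1,L,p,\sigma\big)\ \ge\ \frac{\min\{m,n\}}{2}\Big(\frac{\sigma}{4\varepsilon}\Big)^{\frac{p}{p-1}} .$$
   Context: $\|\cdot\|_{S_1}$ is the nuclear norm, $\|\cdot\|_{S_\infty}$ the spectral norm on $\mathbb R^{m\times n}$. Function class: $\mathcal F_{\Delta_1,L}(m,n)$ is the set of differentiable $F:\mathbb R^{m\times n}\to\mathbb R$ with $\|\nabla F(x)-\nabla F(y)\|_{S_1}\le L\|x-y\|_{S_\infty}$ for all $x,y$ and $F(0)-\inf_xF(x)\le\Delta_1$. Oracle class: $\mathcal O_{p,\sigma}$ is the class of stochastic first-order oracles $O$, where $O$ supplies for each $F\in\mathcal F_{\Delta_1,L}(m,n)$ a stochastic gradient $\nabla f(x,\xi)$ with $\mathbb E[\nabla f(x,\xi)]=\nabla F(x)$ and $\mathbb E[\|\nabla f(x,\xi)-\nabla F(x)\|_{S_1}^p]\le\sigma^p$ for all $x$; successive queries use independent copies $\xi_1,\xi_2,\dots$ of $\xi$. Algorithms: $\mathcal A_{\mathrm{rand}}$ is the class of possibly randomised first-order algorithms. Given the starting point $0$ and a random seed $r$ (independent of everything else), such an algorithm produces iterates $x_1,x_2,\dots$; it observes $g_t=\nabla f(x_t,\xi_t)$,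 and $x_{t+1}$ is a (measurable) function of $r,g_1,\dots,g_t$ (with $x_1$ a function of $r$ only). The algorithm has no other access to $F$. Complexity: $$\mathfrak m^{\mathrm{rand}}_\varepsilon(\|\cdot\|_{S_1},\Delta_1,L,p,\sigma)=\sup_{O\in\mathcal O_{p,\sigma}}\ \sup_{P_F\in\mathcal P[\mathcal F_{\Delta_1,L}(m,n)]}\ \inf_{A\in\mathcal A_{\mathrm{rand}}}\ \inf\{T\in\mathbb N:\ \mathbb E[\|\nabla F(x_T)\|_{S_1}]\le\varepsilon\},$$ where $\mathcal P[\cdot]$ denotes the set of all probability distributions on the class, $F\sim P_F$ is drawn independently of $r$ and the $\xi_t$, the expectation is over $F$, $r$ and $(\xi_t)$, and $\inf\emptyset=+\infty$. *)

(* Defs.v *)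
From HB Require Import structures.
From mathcomp Require Import all_boot all_order all_algebra.
From mathcomp Require Import all_classical all_reals all_analysis.
From mathcomp Require Import complex.

Set Implicit Arguments.
Unset Strict Implicit.
Unset Printing Implicit Defensive.

Import Order.TTheory GRing.Theory Num.Theory.
Import numFieldNormedType.Exports.

Local Open Scope classical_set_scope.
Local Open Scope ring_scope.

Section schatten_norms.
Context {R : realType} {m n : nat}.
Implicit Types A : 'M[R]_(m, n).

(* The eigenvalues of the positive semidefinite matrix A^T A, listed with
   multiplicity; they are computed over R[i], where the library diagonalises
   normal matrices, and are real.  At most minn m n of them are nonzero, so the
   n - minn m n extra zeros (if any) affect neither the sum nor the maximum. *)
Definition singular_value A (i : 'I_n) : R :=
  Num.sqrt (complex.Re
    (spectral_diag (map_mx (real_complex R) (A^T *m A)) ord0 i)).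

Definition nuclear_norm A : R := \sum_(i < n) singular_value A i.

Definition spectral_norm A : R := \big[Num.max/0]_(i < n) singular_value A i.

End schatten_norms.

Section measurable_matrix.
Context {R : realType} {m n : nat}.

(* The sigma-algebra generated by the entries, i.e. the Borel sigma-algebra. *)
HB.instance Definition _ := Measurable.copy 'M[R]_(m, n)
  (g_sigma_algebraType [set A : set 'M[R]_(m, n) |
     exists (i : 'I_m) (j : 'I_n) (B : set R),
       measurable B /\ A = [set M | B (M i j)]]).

End measurable_matrix.

(* The gradient for the trace inner product <A, B> = \tr (A^T *m B); it is the
   matrix of partial derivatives, and is only meaningful where F is
   differentiable. *)
Definition gradient {R : realType} {m n : nat} (F : 'M[R]_(m, n) -> R)
    (x : 'M[R]_(m, n)) : 'M[R]_(m, n) :=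
  \matrix_(i, j) 'D_(delta_mx i j) F x.

(* The infimum is taken in \bar R, so that a function that is unbounded below
   has F 0 - inf F = +oo. *)
Record in_class {R : realType} {m n : nat} (Delta1 L : R)
    (F : 'M[R]_(m, n) -> R) : Prop := InClass {
  class_differentiable : forall x, differentiable F x ;
  class_lipschitz : forall x y,
    nuclear_norm (gradient F x - gradient F y) <= L * spectral_norm (x - y) ;
  class_gap :
    ((F 0)%:E - ereal_inf [set (F x)%:E | x in [set: 'M[R]_(m, n)]]
     <= Delta1%:E)%E }.

Record smooth_fun (R : realType) (m n : nat) (Delta1 L : {posnum R}) :=
  SmoothFun {
    smooth_fun_val :> 'M[R]_(m, n) -> R ;
    smooth_funP : in_class Delta1%:num L%:num smooth_fun_val }.

Section smooth_fun_measurable.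
Context {R : realType} {m n : nat} {Delta1 L : {posnum R}}.
Local Notation smooth_fun := (smooth_fun m n Delta1 L).

HB.instance Definition _ := gen_eqMixin smooth_fun.
HB.instance Definition _ := gen_choiceMixin smooth_fun.

Let spectral_diag0 (C : numClosedFieldType) k :
  spectral_diag (0 : 'M[C]_k) = 0.
Proof.
set Z := (0 : 'M[C]_k); set P := spectralmx Z.
have uP : P \in unitmx := spectral_unit Z.
have ZE : Z = invmx P *m diag_mx (spectral_diag Z) *m P.
  by apply/orthomx_spectralP; rewrite qualifE /= !(mul0mx, mulmx0).
have : P *m Z *m invmx P = diag_mx (spectral_diag Z).
  by rewrite {1}ZE mulmxA mulmxK// mulKVmx.
rewrite mulmx0 mul0mx => /matrixP sZ.
by apply/rowP => i; have := sZ i i; rewrite !mxE eqxx.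
Qed.

Let nuclear_norm0 : nuclear_norm (0 : 'M[R]_(m, n)) = 0.
Proof.
rewrite /nuclear_norm big1// => i _.
by rewrite /singular_value mulmx0 map_mx0 spectral_diag0 mxE sqrtr0.
Qed.

Let in_class0 : in_class Delta1%:num L%:num (cst 0 : 'M[R]_(m, n) -> R).
Proof.
split=> [x|x y|]; first exact: differentiable_cst.
  have g0 z : gradient (cst 0 : 'M[R]_(m, n) -> R) z = 0.
    by apply/matrixP => i j; rewrite [LHS]mxE [RHS]mxE; exact: derive_cst.
  rewrite !g0 subr0 nuclear_norm0 mulr_ge0// /spectral_norm.
  by elim/big_rec: _ => // i u _ u0; rewrite le_max u0 orbT.
rewrite (_ : [set _ | _ in _] = [set 0%E]).
  by rewrite ereal_inf1 -EFinB lee_fin subrr.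
by apply/seteqP; split=> [_ [? _ <-]//|_ ->]; exists 0.
Qed.

HB.instance Definition _ := isPointed.Build smooth_fun (SmoothFun in_class0).

(* The function class carries the sigma-algebra generated by the evaluations
   F |-> F x; distributions on the class are the probability measures on it. *)
HB.instance Definition _ := Measurable.copy smooth_fun
  (g_sigma_algebraType [set A : set smooth_fun |
     exists (x : 'M[R]_(m, n)) (B : set R),
       measurable B /\ A = [set F | B (F x)]]).

End smooth_fun_measurable.

(* oracle_grad F x xi is the stochastic gradient \nabla f(x, xi) that is
   supplied for F.  Joint measurability makes the expectations below genuine
   Lebesgue integrals. *)
Record oracle (R : realType) (m n : nat) (Delta1 L : {posnum R})
    (p sigma : R) := Oracle {
  noise_display : measure_display ;
  noise_space : measurableType noise_display ;
  noise_law : probability noise_space R ;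
  oracle_grad :
    smooth_fun m n Delta1 L -> 'M[R]_(m, n) -> noise_space -> 'M[R]_(m, n) ;
  oracle_measurable : measurable_fun setT
    (fun z : smooth_fun m n Delta1 L * 'M[R]_(m, n) * noise_space =>
       oracle_grad z.1.1 z.1.2 z.2) ;
  oracle_integrable : forall F x i j,
    noise_law.-integrable setT (fun xi => (oracle_grad F x xi i j)%:E) ;
  oracle_unbiased : forall F x i j,
    ('E_noise_law[fun xi => oracle_grad F x xi i j] = (gradient F x i j)%:E)%E ;
  oracle_moment : forall F x,
    ('E_noise_law[fun xi =>
       (nuclear_norm (oracle_grad F x xi - gradient F x) `^ p)%R]
     <= (sigma `^ p)%:E)%E }.

(* query t computes the iterate x_(t+1) from the random seed and the t
   stochastic gradients g_1, ..., g_t observed so far. *)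
Record algorithm (R : realType) (m n : nat) := Algorithm {
  seed_display : measure_display ;
  seed_space : measurableType seed_display ;
  seed_law : probability seed_space R ;
  query : forall t : nat, seed_space * t.-tuple 'M[R]_(m, n) -> 'M[R]_(m, n) ;
  query_measurable : forall t, measurable_fun setT (@query t) }.

Section iid.
Context d {T : measurableType d} {R : realType}.

Definition tuple_cons k (z : T * k.-tuple T) : k.+1.-tuple T :=
  [the k.+1.-tuple T of z.1 :: z.2].

Let measurable_tuple_cons k : measurable_fun setT (@tuple_cons k).
Proof. exact: measurable_cons. Qed.

HB.instance Definition _ k :=
  isMeasurableFun.Build _ _ _ _ (@tuple_cons k)
    (@measurable_tuple_cons k).

(* The law of k independent draws from P, that is, the k-fold product measure
   of P. *)
Fixpoint iid (P : probability T R) (k : nat) : probability (k.-tuple T) R :=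
  if k is k'.+1 then distribution (P \x iid P k')%E (@tuple_cons k')
  else \d_ [tuple].

End iid.

Section complexity.
Context {R : realType} {m n : nat} {Delta1 L : {posnum R}} {p sigma : R}.
Local Notation smooth_fun := (smooth_fun m n Delta1 L).
Implicit Types (O : oracle m n Delta1 L p sigma) (A : algorithm R m n).

(* The gradients g_1, ..., g_t observed when A, with seed r, is run on F against
   O and the noise of the (s+1)-st query is xi s. *)
Fixpoint observations O A (F : smooth_fun) (r : seed_space A)
    (xi : nat -> noise_space O) (t : nat) : t.-tuple 'M[R]_(m, n) :=
  if t is s.+1 then
    let h := observations F r xi s in
    [tuple of rcons h (oracle_grad F (query (r, h)) (xi s))]
  else [tuple].

(* The iterate x_T, for T >= 1. *)
Definition iterate O A (F : smooth_fun) (r : seed_space A)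
    (xi : nat -> noise_space O) (T : nat) : 'M[R]_(m, n) :=
  query (r, observations F r xi T.-1).

(* E ||\nabla F(x_T)||, where F ~ PF, the seed and the noises of the T - 1
   queries on which x_T depends are independent. *)
Definition expected_stationarity O (PF : probability smooth_fun R) A (T : nat)
    : \bar R :=
  ('E_(PF \x (seed_law A \x iid (noise_law O) T.-1))
    [fun w : smooth_fun * (seed_space A * T.-1.-tuple (noise_space O)) =>
       nuclear_norm (gradient w.1
         (iterate (O := O) w.1 w.2.1 (nth point w.2.2) T))])%E.

Definition hitting_time (eps : R) O (PF : probability smooth_fun R) A : \bar R :=
  ereal_inf [set T%:R%:E | T in
    [set T : nat |
      (0 < T)%N /\ (expected_stationarity O PF A T <= eps%:E)%E]].

End complexity.

(* The supremum over oracles and the infimum over algorithms are written with an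
   existential instead of an image because these types, which quantify over all
   sample spaces, are too large to be the domain of a classical set. *)
Definition complexity {R : realType} (m n : nat) (eps : R)
    (Delta1 L : {posnum R}) (p sigma : R) : \bar R :=
  ereal_sup [set v | exists O : oracle m n Delta1 L p sigma, v =
    ereal_sup [set w | exists PF : probability (smooth_fun m n Delta1 L) R, w =
      ereal_inf [set u | exists A : algorithm R m n,
        u = hitting_time eps O PF A]]].

(* Main.v *)
From HB Require Import structures.
Require Import Defs.
From mathcomp Require Import all_boot all_order all_algebra.
From mathcomp Require Import all_classical all_reals all_analysis.
From mathcomp Require Import measurable_realfun complex lra ring.

Set Implicit Arguments.
Unset Strict Implicit.
Unset Printing Implicit Defensive.

Import Order.TTheory GRing.Theory Num.Theory.
Import numFieldNormedType.Exports.

Local Open Scope classical_set_scope.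
Local Open Scope ring_scope.

(** Let r = min(m, n). The hard functions are the quadratics
      F_s(x) = L / (2 r) * sum over k < r of (x_kk - s_k a)^2,   a = 2 eps / L,
    indexed by sign vectors s, and s is drawn uniformly. The gradient of F_s is
    diagonal with entries (L / r) x_kk - s_k c, where c = 2 eps / r. Its nuclear
    norm is the sum of the absolute values of these entries, and it is
    L-Lipschitz because no entry of a matrix exceeds the spectral norm. The gap
    F_s(0) - inf F_s is at most 2 eps^2 / L, which is below Delta1.

    The part of the gradient that depends on s is thus the constant diagonal
    matrix with entries - s_k c. The oracle withholds it: with probability 1 - q
    it returns the gradient without this part, and with probability q / r it
    adds, for one coordinate k only, the entry - s_k c multiplied by r / q.
    The answer is unbiased, and the noise has nuclear norm at most
    2 eps / q + 2 eps in the second case and 2 eps in the first one, so for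
    q = (4 eps / sigma)^(p / (p - 1)) its p-th moment is at most sigma^p
    ([noise_moment_le]). To make sense on the whole class, the oracle reads the
    withheld part off the gradient of F at 0, truncated to [-c, c].

    As long as coordinate k has not been revealed, the run is the same for s and
    for s with its k-th sign flipped ([observations_flip]). The k-th diagonal
    entries of the two gradients at the common iterate differ by 2 c, so on
    average over s this entry has absolute value at least c
    ([average_gradient]). The T - 1 queries that precede x_T miss k with
    probability (1 - q / r)^(T - 1), and summing over k gives
      E || grad F(x_T) || >= 2 eps (1 - q / r)^(T - 1)
                          >= 2 eps (1 - (T - 1) q / r)
    ([expected_stationarity_ge]), which exceeds eps when T < r / (2 q).

    Two measurability questions arise. A jointly measurable oracle needs the
    gradient to be a measurable function of the pair (F, x)
    ([measurable_gradient]). In the expectation to be bounded below, the nuclear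
    norm is replaced by the sum of the absolute values of the diagonal entries,
    a measurable minorant ([sum_diag_le_nuclear_norm]), before Tonelli's theorem
    is applied. *)

(** * Singular values and diagonal entries *)

Lemma sum_widen_le (K : numDomainType) (a b : nat) (ab : (a <= b)%N) (f : 'I_b -> K) :
  (forall i, 0 <= f i) -> \sum_(i < a) f (widen_ord ab i) <= \sum_i f i.
Proof.
move=> f0; rewrite [leRHS](bigID (fun i : 'I_b => (i < a)%N))/= big_ord_narrow.
by rewrite lerDl sumr_ge0.
Qed.

Section diagonal_entries.
Context {R : realType} {m n : nat}.
Local Notation r := (minn m n).

Definition diag_row (k : 'I_r) : 'I_m := widen_ord (geq_minl m n) k.
Definition diag_col (k : 'I_r) : 'I_n := widen_ord (geq_minr m n) k.

Definition diag_entry (x : 'M[R]_(m, n)) k : R := x (diag_row k) (diag_col k).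

Lemma diag_row_inj : injective diag_row.
Proof. by move=> k l /(congr1 val)/= /val_inj. Qed.

Lemma diag_col_inj : injective diag_col.
Proof. by move=> k l /(congr1 val)/= /val_inj. Qed.

End diagonal_entries.

Section singular_values.
Context {R : realType} {m n : nat}.
Implicit Types A : 'M[R]_(m, n).
Local Notation toC := (real_complex R).

Let gram A := map_mx toC (A^T *m A).

Let gram_hermsym A : gram A \is hermsymmx.
Proof.
apply/is_hermitianmxP; rewrite expr0 scale1r; apply/matrixP => i j.
rewrite !mxE conj_Creal; last by apply/complex_realP; eexists.
by congr (toC _); apply: eq_bigr => k _; rewrite !mxE mulrC.
Qed.

Let gramE A : gram A = invmx (spectralmx (gram A))
  *m diag_mx (spectral_diag (gram A)) *m spectralmx (gram A).
Proof. exact/orthomx_spectralP/hermitian_normalmx/gram_hermsym. Qed.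

Let spectral_real A i : spectral_diag (gram A) ord0 i =
  toC (complex.Re (spectral_diag (gram A) ord0 i)).
Proof.
by rewrite RRe_real//; exact: (mxOverP (hermitian_spectral_diag_real (gram_hermsym A))).
Qed.

(** A^T A is similar to the diagonal matrix of its eigenvalues, so the two have
    the same characteristic polynomial; by unique factorisation the eigenvalues
    are the entries of d up to order. *)
Lemma nuclear_norm_gram_diag A (d : 'rV[R]_n) : A^T *m A = diag_mx d ->
  nuclear_norm A = \sum_(i < n) Num.sqrt (d ord0 i).
Proof.
move=> AE.
have char_gram : char_poly (gram A) = char_poly (diag_mx (spectral_diag (gram A))).
  set P := spectralmx (gram A); set D := diag_mx _.
  have uP : P \in unitmx := spectral_unit (gram A).
  have PV : map_mx polyC (invmx P) *m map_mx polyC P = 1%:M.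
    by rewrite -map_mxM mulVmx// map_mx1.
  rewrite /char_poly; have -> : char_poly_mx (gram A) =
      map_mx polyC (invmx P) *m char_poly_mx D *m map_mx polyC P.
    rewrite /char_poly_mx mulmxBr mulmxBl -!map_mxM -gramE.
    by congr (_ - _); rewrite scalar_mxC -mulmxA PV mulmx1.
  by rewrite !det_mulmx mulrAC -det_mulmx PV det1 mul1r.
have : perm_eq [seq spectral_diag (gram A) ord0 i | i <- index_enum 'I_n]
               [seq toC (d ord0 i) | i <- index_enum 'I_n].
  apply: prod_XsubC_eq; rewrite !big_map.
  move: char_gram; rewrite char_poly_trig; last first.
    by rewrite /gram AE map_diag_mx; exact/diag_mx_is_trig.
  rewrite char_poly_trig; last exact/diag_mx_is_trig.
  move=> /esym EE.
  transitivity (\prod_(i < n) ('X - (diag_mx (spectral_diag (gram A)) i i)%:P)).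
    by apply: eq_bigr => i _; rewrite mxE eqxx mulr1n.
  by rewrite EE; apply: eq_bigr => i _; rewrite /gram AE !mxE eqxx mulr1n.
move=> /(perm_map (fun z : R[i] => Num.sqrt (complex.Re z))) pE.
have : \sum_(x <- [seq Num.sqrt (complex.Re z)
           | z <- [seq spectral_diag (gram A) ord0 i | i <- index_enum 'I_n]]) x =
       \sum_(x <- [seq Num.sqrt (complex.Re z)
           | z <- [seq toC (d ord0 i) | i <- index_enum 'I_n]]) x.
  exact: perm_big.
by rewrite !big_map.
Qed.

(** The square of A i j is at most the j-th diagonal entry of A^T A, and this
    entry is a convex combination of the eigenvalues of A^T A. *)
Lemma le_spectral_norm A i j : `|A i j| <= spectral_norm A.
Proof.
have S_ge0 : 0 <= spectral_norm A.
  by rewrite /spectral_norm; elim/big_rec: _ => // k u _ u0; rewrite le_max u0 orbT.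
set P := spectralmx (gram A).
have uP : P \is unitarymx := spectral_unitarymx (gram A).
have PP : (P ^t* )%sesqui *m P = 1%:M.
  by rewrite -invmx_unitary// mulVmx// spectral_unit.
have col1 : \sum_k `|P k j| ^+ 2 = 1.
  have /matrixP/(_ j j) := PP; rewrite mxE [RHS]mxE eqxx mulr1n => <-.
  by apply: eq_bigr => k _; rewrite !mxE normCKC.
suff : toC (\sum_k A k j ^+ 2) <= toC (spectral_norm A ^+ 2).
  rewrite lecR => AS.
  rewrite -(ler_pXn2r (n := 2))// ?nnegrE// real_normK ?num_real//.
  by apply: le_trans AS; rewrite (bigD1 i)//= lerDl sumr_ge0// => k _; rewrite sqr_ge0.
have -> : toC (\sum_k A k j ^+ 2) = \sum_k `|P k j| ^+ 2 * spectral_diag (gram A) ord0 k.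
  transitivity (gram A j j).
    by rewrite !mxE; congr (toC _); apply: eq_bigr => k _; rewrite !mxE expr2.
  rewrite {1}gramE -/P invmx_unitary// mxE; apply: eq_bigr => k _.
  by rewrite mul_mx_diag !mxE mulrAC normCKC.
rewrite -[X in _ <= X]mul1r -col1 mulr_suml; apply: ler_sum => k _.
rewrite ler_wpM2l ?exprn_ge0// spectral_real lecR.
have := le_bigmax 0 (singular_value A) k; rewrite -/(spectral_norm A) => sS.
have [l0|l0] := ltP (complex.Re (spectral_diag (gram A) ord0 k)) 0.
  by rewrite (le_trans (ltW l0))// sqr_ge0.
by rewrite -[leLHS]sqr_sqrtr// ler_pXn2r ?nnegrE ?sqrtr_ge0.
Qed.

(** Write A = X P with P the unitary matrix that diagonalises A^T A. Column k of
    X has Euclidean norm the k-th singular value and row k of P has norm 1, so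
    the Cauchy-Schwarz inequality bounds the contribution of each k to the sum of
    the |A_ll| = |sum over k of X_lk P_kl|. *)
Lemma sum_diag_le_nuclear_norm A : \sum_k `|diag_entry A k| <= nuclear_norm A.
Proof.
set P := spectralmx (gram A); pose X := map_mx toC A *m invmx P.
have uP : P \is unitarymx := spectral_unitarymx (gram A).
have unitP : P \in unitmx := spectral_unit (gram A).
have AE : map_mx toC A = X *m P by rewrite mulmxKV.
have colX k : \sum_a `|X a k| ^+ 2 = toC (singular_value A k ^+ 2).
  have XX : \sum_a `|X a k| ^+ 2 = spectral_diag (gram A) ord0 k.
    transitivity ((P *m gram A *m invmx P) k k); last first.
      rewrite [X in _ *m X *m _]gramE -/P !mulmxA mulmxV// mul1mx mulmxK//.
      by rewrite mxE eqxx mulr1n.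
    have -> : P *m gram A *m invmx P = (P *m map_mx toC A^T) *m X.
      by rewrite /gram map_mxM !mulmxA.
    have <- : (X ^t* )%sesqui = P *m map_mx toC A^T.
      rewrite trmx_mul map_mxM invmx_unitary// trmxCK; congr (_ *m _).
      by apply/matrixP => a b; rewrite !mxE/= conj_Creal//; apply/complex_realP; eexists.
    by rewrite [RHS]mxE; apply: eq_bigr => a _; rewrite !mxE normCKC.
  have : 0 <= spectral_diag (gram A) ord0 k.
    by rewrite -XX sumr_ge0// => a _; rewrite exprn_ge0.
  rewrite XX spectral_real lecR => l0.
  by rewrite /singular_value -/(gram A) sqr_sqrtr.
have rowP k : \sum_b `|P k b| ^+ 2 = 1.
  have /unitarymxP/matrixP/(_ k k) := uP; rewrite mxE [RHS]mxE eqxx mulr1n => <-.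
  by apply: eq_bigr => b _; rewrite !mxE normCK.
rewrite -lecR /nuclear_norm !rmorph_sum/=.
apply: (@le_trans _ _ (\sum_(l < minn m n) \sum_k `|X (diag_row l) k| * `|P k (diag_col l)|)).
  apply: ler_sum => l _.
  have -> : toC `|diag_entry A l| = `|(X *m P) (diag_row l) (diag_col l)|.
    by rewrite -AE mxE normc_def/= expr0n/= addr0 sqrtr_sqr.
  rewrite mxE; apply: le_trans (ler_norm_sum _ _ _) _; apply: ler_sum => k _.
  by rewrite normrM.
rewrite exchange_big/=; apply: ler_sum => k _.
set s := toC (singular_value A k).
have s0 : 0 <= s by rewrite lecR sqrtr_ge0.
have Xs : \sum_(l < minn m n) `|X (diag_row l) k| ^+ 2 <= s ^+ 2.
  rewrite (_ : s ^+ 2 = \sum_a `|X a k| ^+ 2); last by rewrite colX rmorphXn.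
  by apply: (sum_widen_le _ (f := fun a => `|X a k| ^+ 2)) => a; rewrite exprn_ge0.
have P1 : \sum_(l < minn m n) `|P k (diag_col l)| ^+ 2 <= 1.
  rewrite -(rowP k).
  by apply: (sum_widen_le _ (f := fun b => `|P k b| ^+ 2)) => b; rewrite exprn_ge0.
(* The Cauchy-Schwarz inequality for this k, from 2 s u v <= u^2 + s^2 v^2; this
   divides by s, so a zero singular value, for which column k of X vanishes, is
   treated apart. *)
have [s_eq0|s_neq0] := eqVneq s 0.
  rewrite s_eq0 big1// => l _.
  have X0 : `|X (diag_row l) k| ^+ 2 <= 0.
    have := Xs; rewrite s_eq0 expr0n/=; apply: le_trans.
    by rewrite (bigD1 l)//= lerDl sumr_ge0// => i _; rewrite exprn_ge0.
  have /eqP : `|X (diag_row l) k| ^+ 2 = 0.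
    by apply/le_anti; rewrite X0 exprn_ge0.
  by rewrite sqrf_eq0 => /eqP ->; rewrite mul0r.
rewrite -(ler_pM2l (_ : 0 < 2 * s)); last by rewrite mulr_gt0 ?ltr0n// lt_def s_neq0.
apply: (@le_trans _ _ (\sum_(l < minn m n)
    (`|X (diag_row l) k| ^+ 2 + s ^+ 2 * `|P k (diag_col l)| ^+ 2))).
  rewrite mulr_sumr; apply: ler_sum => l _.
  set u := `|X _ _|; set v := `|P _ _|.
  have uvR : u - s * v \is Num.real.
    by rewrite realB ?realM ?normr_real// ger0_real.
  rewrite -subr_ge0 (_ : _ - _ = (u - s * v) ^+ 2); last by ring.
  by rewrite real_exprn_even_ge0.
rewrite big_split/= -mulr_sumr (_ : 2 * s * s = s ^+ 2 + s ^+ 2); last by ring.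
rewrite lerD// ler_piMr ?exprn_ge0//.
Qed.

End singular_values.

Section rectangular_diagonal.
Context {R : realType} {m n : nat}.
Local Notation r := (minn m n).
Implicit Types (d : 'I_r -> R) (x : 'M[R]_(m, n)).

Definition diag_rect d : 'M[R]_(m, n) :=
  \sum_k d k *: delta_mx (diag_row k) (diag_col k).

Lemma diag_rectE d i j :
  diag_rect d i j = \sum_k d k * ((i == diag_row k) && (j == diag_col k))%:R.
Proof. by rewrite summxE; apply: eq_bigr => k _; rewrite !mxE. Qed.

Lemma diag_rectK d k : diag_entry (diag_rect d) k = d k.
Proof.
rewrite /diag_entry diag_rectE (bigD1 k)//= !eqxx mulr1 big1 ?addr0// => l lk.
by rewrite (inj_eq diag_row_inj) eq_sym (negbTE lk) mulr0.
Qed.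

Lemma diag_rectB d d' : diag_rect d - diag_rect d' = diag_rect (fun k => d k - d' k).
Proof. by rewrite /diag_rect -sumrB; apply: eq_bigr => k _; rewrite scalerBl. Qed.

Lemma nuclear_norm_diag_rect d : nuclear_norm (diag_rect d) = \sum_k `|d k|.
Proof.
pose q : 'rV[R]_n := \row_j \sum_k d k ^+ 2 * (j == diag_col k)%:R.
have gramE : (diag_rect d)^T *m diag_rect d = diag_mx q.
  have -> : (diag_rect d)^T = \sum_k d k *: delta_mx (diag_col k) (diag_row k).
    apply/matrixP => i j; rewrite mxE diag_rectE summxE.
    by apply: eq_bigr => k _; rewrite !mxE andbC.
  rewrite mulmx_suml.
  apply/matrixP => i j; rewrite summxE !mxE -sumrMnl; apply: eq_bigr => k _.
  rewrite mulmx_sumr summxE (bigD1 k)//= big1 ?addr0; last first.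
    move=> l lk; rewrite -scalemxAl -scalemxAr mul_delta_mx_cond.
    by rewrite (inj_eq diag_row_inj) eq_sym (negbTE lk) mulr0n !mxE !mulr0.
  rewrite -scalemxAl -scalemxAr mul_delta_mx !mxE.
  have [->|ij] := eqVneq i j; first by rewrite mulr1n andbb expr2 mulrA.
  rewrite mulr0n; case: eqP => [ik|]; last by rewrite !mulr0.
  by rewrite -ik eq_sym (negbTE ij) !mulr0.
rewrite (nuclear_norm_gram_diag gramE).
transitivity (\sum_(j < n) \sum_k `|d k| * (j == diag_col k)%:R).
  apply: eq_bigr => j _; rewrite mxE.
  have [k jk|jN] := pickP (fun k : 'I_(minn m n) => j == diag_col k).
    rewrite (bigD1 k)//= jk mulr1 big1 ?addr0; last first.
      by move=> l lk; rewrite (eqP jk) (inj_eq diag_col_inj) eq_sym (negbTE lk) mulr0.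
    rewrite sqrtr_sqr (bigD1 k)//= jk mulr1 big1 ?addr0// => l lk.
    by rewrite (eqP jk) (inj_eq diag_col_inj) eq_sym (negbTE lk) mulr0.
  by rewrite !big1 ?sqrtr0// => k _; rewrite jN mulr0.
rewrite exchange_big/=; apply: eq_bigr => k _; rewrite -mulr_sumr.
by rewrite (bigD1 (diag_col k))//= eqxx big1 ?addr0 ?mulr1// => j /negbTE ->.
Qed.

End rectangular_diagonal.

(** * Quadratic functions of the diagonal *)

Section quadratic.
Context {R : realType} {m n : nat}.
Local Notation r := (minn m n).
Implicit Types (c : 'I_r -> R) (x v : 'M[R]_(m, n)).

Lemma is_derive_entry x v i j : is_derive x v (fun y : 'M[R]_(m, n) => y i j) (v i j).
Proof.
have dc : derivable (fun y : 'M[R]_(m, n) => y i j : R) x v.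
  exact/diff_derivable/differentiable_coord.
apply: (DeriveDef dc).
apply/cvg_lim => //.
apply: (cvg_near_cst (T := R)); near=> h; rewrite /= !mxE addrK.
rewrite -[LHS]/(h^-1 * (h * v i j)) mulKf//.
by near: h; exact: nbhs_dnbhs_neq.
Unshelve. all: by end_near. Qed.

Definition quadratic (L : R) c x : R :=
  L / (2 * r%:R) * \sum_k (diag_entry x k - c k) ^+ 2.

Lemma quadraticE L c : quadratic L c = (L / (2 * r%:R)) \*:
  \sum_(k < r) ((fun y : 'M[R]_(m, n) => y (diag_row k) (diag_col k)) - cst (c k)) ^+ 2.
Proof.
apply/funext => x; rewrite /quadratic /GRing.scale/= fct_sumE; congr (_ * _).
Qed.

Lemma differentiable_quadratic L c x : differentiable (quadratic L c) x.
Proof.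
rewrite quadraticE; apply: differentiableZ; apply: differentiable_sum => k.
apply: differentiableX; apply: differentiableB; last exact: differentiable_cst.
exact: differentiable_coord.
Qed.

Lemma gradient_quadratic L c x : (0 < r)%N ->
  gradient (quadratic L c) x = diag_rect (fun k => L / r%:R * (diag_entry x k - c k)).
Proof.
move=> r0; apply/matrixP => i j; rewrite mxE diag_rectE quadraticE.
have dk (k : 'I_r) : is_derive x (delta_mx i j)
    (((fun y : 'M[R]_(m, n) => y (diag_row k) (diag_col k)) - cst (c k)) ^+ 2)
    (2 * (diag_entry x k - c k) * (delta_mx i j (diag_row k) (diag_col k) - 0)).
  by apply: is_deriveX; apply: is_deriveB; exact: is_derive_entry.
have dF := is_deriveZ (L / (2 * r%:R)) (is_derive_sum dk).
rewrite (@derive_val _ _ _ _ _ _ _ dF).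
rewrite -[LHS]/(_ * _) mulr_sumr; apply: eq_bigr => k _.
rewrite subr0 !mxE eq_sym [_ == j]eq_sym.
have r0' : r%:R != 0 :> R by rewrite pnatr_eq0 -lt0n.
by field.
Qed.

(** Each diagonal derivative is (L / r)-Lipschitz in its own entry, and the r of
    them add up to L times the largest entry of x - y. *)
Lemma in_class_quadratic (Delta1 L : R) c : (0 < r)%N -> 0 < L ->
  L / (2 * r%:R) * (\sum_k c k ^+ 2) <= Delta1 ->
  in_class Delta1 L (quadratic L c).
Proof.
move=> r0 L0 cD; split; first exact: differentiable_quadratic.
- have Lr0 : 0 <= L / r%:R by rewrite divr_ge0// ltW.
  move=> x y; rewrite !gradient_quadratic// diag_rectB nuclear_norm_diag_rect.
  apply: (@le_trans _ _ (\sum_(k < r) L / r%:R * spectral_norm (x - y))).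
    apply: ler_sum => k _; rewrite -mulrBr opprB addrA subrK normrM.
    rewrite ger0_norm// ler_wpM2l//.
    by have := le_spectral_norm (x - y) (diag_row k) (diag_col k); rewrite !mxE.
  rewrite sumr_const card_ord -mulrnAl -[X in X * _]mulr_natr divfK//.
  by rewrite pnatr_eq0 -lt0n.
- have inf0 : (0 <= ereal_inf [set (quadratic L c x)%:E | x in [set: 'M[R]_(m, n)]])%E.
    apply/ereal_infP => _ [x _ <-]; rewrite lee_fin mulr_ge0 ?divr_ge0 ?(ltW L0)//.
    by apply: sumr_ge0 => k _; exact: sqr_ge0.
  apply: (@le_trans _ _ (quadratic L c 0)%:E).
    by rewrite -[leRHS]sube0 leeB.
  rewrite lee_fin; apply: le_trans cD; rewrite /quadratic.
  by under eq_bigr do rewrite /diag_entry mxE sub0r sqrrN.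
Qed.

End quadratic.

(** * Joint measurability of the gradient *)

Section matrix_measurability.
Context {R : realType} {m n : nat}.

Lemma measurable_entry (i : 'I_m) (j : 'I_n) :
  measurable_fun setT (fun x : 'M[R]_(m, n) => x i j).
Proof.
move=> _ B mB; rewrite setTI; apply: sub_sigma_algebra; exists i, j, B; split => //.
Qed.

Lemma measurable_matrixP d (T : measurableType d) (f : T -> 'M[R]_(m, n)) :
  (forall i j, measurable_fun setT (fun t => f t i j)) -> measurable_fun setT f.
Proof.
move=> mf; apply: (@measurability _ _ _ _ _ _ [set A : set 'M[R]_(m, n) |
     exists (i : 'I_m) (j : 'I_n) (B : set R),
       measurable B /\ A = [set M | B (M i j)]]) => //.
move=> _ [_ [i [j [B [mB ->]]]] <-]; exact: mf.
Qed.

Lemma measurable_diag_rect d (T : measurableType d)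
    (f : T -> 'I_(minn m n) -> R) :
  (forall k, measurable_fun setT (fun t => f t k)) ->
  measurable_fun setT (fun t => diag_rect (f t) : 'M[R]_(m, n)).
Proof.
move=> mf; apply: measurable_matrixP => i j.
under eq_fun do rewrite diag_rectE.
by apply: measurable_sum => k; apply: measurable_funM.
Qed.

End matrix_measurability.

Section gradient_measurability.
Context {R : realType} {m n : nat} {Delta1 L : {posnum R}}.
Local Notation smooth_fun := (smooth_fun m n Delta1 L).

Lemma measurable_eval (x : 'M[R]_(m, n)) :
  measurable_fun setT (fun F : smooth_fun => F x).
Proof.
by move=> _ B mB; rewrite setTI; apply: sub_sigma_algebra; exists x, B; split.
Qed.

(** The grid of mesh 1 / (k + 1): the integer label of the cell that contains x,
    and the lower corner of the cell with a given label. *)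
Let cell k (x : 'M[R]_(m, n)) : 'M[int]_(m, n) :=
  map_mx (fun t => Num.floor (k.+1%:R * t)) x.
Let corner k (z : 'M[int]_(m, n)) : 'M[R]_(m, n) :=
  map_mx (fun t : int => k.+1%:R^-1 * t%:~R) z.

Let measurable_cell k z : measurable [set x | cell k x = z].
Proof.
rewrite (_ : [set x | _] = \bigcap_(i in [set: 'I_m]) \bigcap_(j in [set: 'I_n])
    ((fun x : 'M[R]_(m, n) => k.+1%:R * x i j) @^-1` `[(z i j)%:~R, (z i j + 1)%:~R[)).
  apply: fin_bigcap_measurable => // i _; apply: fin_bigcap_measurable => // j _.
  rewrite -[X in measurable X]setTI.
  have mf : measurable_fun setT (fun x : 'M[R]_(m, n) => k.+1%:R * x i j).
    by apply: measurable_funM => //; exact: measurable_entry.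
  exact: mf.
apply/seteqP; split=> [x <- i _ j _|x xz].
  by rewrite /= in_itv/= mxE floor_itv.
apply/matrixP => i j; rewrite mxE; apply/eqP; rewrite floor_eq.
by have := xz i Logic.I j Logic.I; rewrite /= in_itv.
Qed.

Let measurable_eval_corner k :
  measurable_fun setT (fun z : smooth_fun * 'M[R]_(m, n) => z.1 (corner k (cell k z.2))).
Proof.
move=> _ B mB; rewrite setTI.
rewrite (_ : _ @^-1` _ = \bigcup_(c in [set: 'M[int]_(m, n)])
   ([set F : smooth_fun | B (F (corner k c))] `*` [set x | cell k x = c])).
  apply: countable_bigcupT_measurable; first exact: countableP.
  move=> c; apply: measurableX => //.
  by rewrite -[X in measurable X]setTI; exact: measurable_eval.
apply/seteqP; split=> [z Bz|z [c _ [/= Bz zc]]].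
  by exists (cell k z.2).
by rewrite /= zc.
Qed.

Let cvg_corner x : corner k (cell k x) @[k --> \oo] --> x.
Proof.
apply/cvg_ballP => e e0.
have := @cvg_harmonic R; move=> /cvgrPdist_lt/(_ e e0).
apply: filter_app; near=> k; rewrite sub0r normrN => ke; split=> // i j.
rewrite /ball/= !mxE.
have /andP[fl fu] := floor_itv (k.+1%:R * x i j).
have kp : 0 < k.+1%:R^-1 :> R by rewrite invr_gt0 ltr0n.
have xE : x i j = k.+1%:R^-1 * (k.+1%:R * x i j) by rewrite mulKf// pnatr_eq0.
rewrite [X in X - _]xE -mulrBr normrM gtr0_norm//.
apply: le_lt_trans ke; rewrite /harmonic [leRHS]gtr0_norm// ler_piMr ?(ltW kp)//.
rewrite ger0_norm ?subr_ge0// lerBlDl (le_trans (ltW fu))// intrD//.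
Unshelve. all: by end_near. Qed.

(** Evaluation is measurable in F and continuous in x: it is the limit of the
    evaluations at the corner of the cell of x, and these are measurable because
    there are countably many cells. *)
Lemma measurable_joint_eval :
  measurable_fun setT (fun z : smooth_fun * 'M[R]_(m, n) => z.1 z.2).
Proof.
apply: (@measurable_fun_cvg _ _ R setT
  (fun k (z : smooth_fun * 'M[R]_(m, n)) => z.1 (corner k (cell k z.2)))
  (fun z : smooth_fun * 'M[R]_(m, n) => z.1 z.2)).
  by move=> k; exact: measurable_eval_corner.
move=> [F x] _ /=.
have Fx : {for x, continuous F}.
  exact/differentiable_continuous/(class_differentiable (smooth_funP F)).
exact: (cvg_comp _ _ (@cvg_corner x) Fx).
Qed.

(** The partial derivatives are limits of the difference quotients with steps
    1 / (k + 1). *)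
Lemma measurable_gradient : measurable_fun setT
  (fun z : smooth_fun * 'M[R]_(m, n) => gradient z.1 z.2).
Proof.
apply: measurable_matrixP => i j.
apply: (@eq_measurable_fun _ _ _ _ setT (fun z : smooth_fun * 'M[R]_(m, n) =>
  'D_(delta_mx i j) z.1 z.2)) => [z _|]; first by rewrite mxE.
apply: (measurable_fun_cvg (h := fun k (z : smooth_fun * 'M[R]_(m, n)) =>
  k.+1%:R * (z.1 (k.+1%:R^-1 *: delta_mx i j + z.2) - z.1 z.2))).
  move=> k.
  pose g (z : smooth_fun * 'M[R]_(m, n)) := (z.1, k.+1%:R^-1 *: delta_mx i j + z.2).
  have mg : measurable_fun setT g.
    apply: measurable_fun_pair; first exact: measurable_fst.
    apply: measurable_matrixP => a b.
    apply: (@eq_measurable_fun _ _ _ _ setT (fun z : smooth_fun * 'M[R]_(m, n) =>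
      (k.+1%:R^-1 *: delta_mx i j : 'M[R]_(m, n)) a b + z.2 a b)) => [z _|].
      by rewrite [RHS]mxE.
    apply: measurable_funD => //.
    exact: (measurableT_comp (measurable_entry a b) measurable_snd).
  apply: measurable_funM => //; apply: measurable_funB.
    exact: (measurableT_comp measurable_joint_eval mg).
  exact: measurable_joint_eval.
move=> [F x] _ /=.
have dF : derivable F x (delta_mx i j).
  exact/diff_derivable/(class_differentiable (smooth_funP F)).
have harm0 : (fun k => k.+1%:R^-1 : R) @ \oo --> 0^'.
  move=> U; rewrite /dnbhs /within/= => U0.
  have : \forall k \near \oo, (harmonic k : R) != 0 -> U (harmonic k).
    exact: (@cvg_harmonic R _ U0).
  by apply: (@filterS _ \oo) => k; apply; rewrite invr_eq0 pnatr_eq0.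
have -> : (fun k => k.+1%:R * (F (k.+1%:R^-1 *: delta_mx i j + x) - F x)) =
    (fun h : R => h^-1 *: ((F \o shift x) (h *: delta_mx i j) - F x)) \o
    (fun k => k.+1%:R^-1).
  by apply/funext => k; rewrite /= invrK.
exact: (cvg_comp _ _ harm0 dF).
Qed.

End gradient_measurability.

(** * Laws with finite support *)

Section nonnegative_integrals.
Local Open Scope ereal_scope.
Context d (T : measurableType d) (R : realType).

(** Both integrals are suprema over the simple functions below the integrand; the
    inequality is applied with the nuclear norm of a gradient as g. *)
Lemma le_integral_ge0 (mu : {measure set T -> \bar R}) (f g : T -> \bar R) :
  (forall x, 0 <= f x) -> (forall x, f x <= g x) ->
  \int[mu]_x f x <= \int[mu]_x g x.
Proof.
move=> f0 fg; have g0 x : 0 <= g x by exact: le_trans (fg x).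
rewrite !ge0_integralTE//; apply: ereal_sup_le => _ [h hf <-].
by exists h => // x; exact: le_trans (fg x).
Qed.

(** P is the mixture of the Dirac masses at the z i with weights w i. It is
    described by its integrals, the form in which every later computation uses
    it. *)
Definition finite_law (I : finType) (w : I -> R) (z : I -> T) (P : probability T R) :=
  forall f : T -> \bar R, measurable_fun setT f ->
    (forall x, 0 <= f x) -> \int[P]_x f x = \sum_i (w i)%:E * f (z i).

Lemma finite_law_exists (I : finType) (i0 : I) (w : I -> R) (z : I -> T) :
  (forall i, 0 <= w i)%R -> (\sum_i w i = 1)%R ->
  exists P : probability T R, finite_law w z P.
Proof.
(* Finite sums of measures are indexed by an initial segment of nat, hence the
   enumeration e of I; the default i0 is never reached. *)
move=> w0 w1; pose e k := nth i0 (enum I) k.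
pose mu_ k : {measure set T -> \bar R} := mscale (NngNum (w0 (e k))) \d_(z (e k)).
pose mu := msum mu_ #|I|.
have muE (f : T -> \bar R) : measurable_fun setT f -> (forall x, 0 <= f x) ->
    \int[mu]_x f x = \sum_i (w i)%:E * f (z i).
  move=> mf f0; rewrite /mu ge0_integral_measure_sum//.
  rewrite -[RHS]big_enum/= (big_nth i0) -cardE big_mkord; apply: eq_bigr => k _.
  rewrite ge0_integral_mscale//= integral_dirac// diracT mul1e//.
have mu1 : mu setT = 1.
  have := muE (cst 1) (measurable_cst _) (fun=> lee01).
  rewrite integral_cst// mul1e => muT; rewrite [LHS]muT.
  by under eq_bigr do rewrite mule1; rewrite sumEFin w1.
have mu_prob := Measure_isProbability.Build _ _ _ mu mu1.
by exists (HB.pack_for (probability T R) (msum mu_ #|I|) mu_prob).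
Qed.

Lemma finite_law_integral (I : finType) (w : I -> R) (z : I -> T)
    (P : probability T R) (f : T -> R) : finite_law w z P -> measurable_fun setT f ->
  \int[P]_x (f x)%:E = (\sum_i w i * f (z i))%:E.
Proof.
move=> Pwz mf; rewrite integralE.
have mfE : measurable_fun setT (fun x => (f x)%:E) by exact/measurable_EFinP.
rewrite !Pwz//; [|exact: measurable_funeneg|exact: measurable_funepos].
under eq_bigr do rewrite funeposE -EFin_max -EFinM.
rewrite sumEFin.
under [X in _ - X]eq_bigr do rewrite funenegE -EFin_max -EFinM.
rewrite sumEFin -EFinB -sumrB; congr EFin; apply: eq_bigr => i _.
rewrite -mulrBr; congr (_ * _)%R.
by case: (leP 0%R (f (z i))) => h; [rewrite (max_idPr _)// ?oppr_le0// | rewrite (max_idPl _)]; lra.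
Qed.

Lemma finite_law_integrable (I : finType) (w : I -> R) (z : I -> T)
    (P : probability T R) (f : T -> R) : finite_law w z P -> measurable_fun setT f ->
  P.-integrable setT (fun x => (f x)%:E).
Proof.
move=> Pwz mf; apply/integrableP; split; first exact/measurable_EFinP.
have mnf : measurable_fun setT (fun x => `|f x|)%R.
  exact: (measurableT_comp (@normr_measurable _ setT) mf).
under eq_integral do rewrite abse_EFin.
by rewrite (finite_law_integral Pwz mnf) ltry.
Qed.

End nonnegative_integrals.

Lemma integral_sum_indic d (T : measurableType d) (R : realType)
    (mu : {measure set T -> \bar R}) (N : nat) (B : 'I_N -> set T) (c b : R) :
  0 <= c -> (forall i, measurable (B i)) -> (forall i, mu (B i) = b%:E) ->
  (\int[mu]_y (\sum_i c * \1_(B i) y)%:E = (N%:R * c * b)%:E)%E.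
Proof.
move=> c0 mB muB; under eq_integral do rewrite -sumEFin.
have mind i : measurable_fun setT (\1_(B i) : T -> R) by exact: measurable_indic.
rewrite ge0_integral_sum//; last 2 first.
- by move=> i; apply/measurable_EFinP; apply: measurable_funM.
- by move=> i y _; rewrite lee_fin mulr_ge0.
transitivity (\sum_(i < N) (c * b)%:E)%E.
  apply: eq_bigr => i _; under eq_integral do rewrite EFinM.
  have mindE : measurable_fun setT (fun y => (\1_(B i) y)%:E : \bar R).
    exact/measurable_EFinP.
  rewrite ge0_integralZl//.
  by rewrite integral_indic// setIT [X in (_ * X)%E]muB EFinM.
by rewrite sumEFin sumr_const card_ord -mulrA mulr_natl.
Qed.

(** * The oracle *)

Section revealing_oracle.
Context {R : realType} {m n : nat} {Delta1 L : {posnum R}}.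
Local Notation r := (minn m n).
Local Notation smooth_fun := (smooth_fun m n Delta1 L).
Variables (c q : R).
Hypotheses (r_gt0 : (0 < r)%N) (c_ge0 : 0 <= c) (q_gt0 : 0 < q) (q_le1 : q <= 1).

(** For a hard function this is the part of the gradient that depends on the
    hidden signs, and the truncation has no effect. For any other F of the class
    it is a measurable quantity bounded by c, which is all that the oracle
    conditions require. *)
Definition secret (F : smooth_fun) (k : 'I_r) : R :=
  Num.max (- c) (Num.min c (diag_entry (gradient F 0) k)).

(** The factor r / q is the inverse of the probability that k is revealed. *)
Definition revealed (F : smooth_fun) (xi : nat) (k : 'I_r) : R :=
  if xi == k then r%:R / q * secret F k else 0.

Definition revealing_grad (F : smooth_fun) (x : 'M[R]_(m, n)) (xi : nat)
    : 'M[R]_(m, n) :=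
  gradient F x + diag_rect (fun k => revealed F xi k - secret F k).

(** The noise k < r reveals coordinate k, and the noise r reveals nothing. *)
Definition noise_weight (k : 'I_r.+1) : R := if (k < r)%N then q / r%:R else 1 - q.

Lemma noise_weight_ge0 k : 0 <= noise_weight k.
Proof.
by rewrite /noise_weight; case: ifP => _; rewrite ?subr_ge0// divr_ge0// ltW.
Qed.

Lemma sum_noise_weight (f : nat -> R) :
  \sum_(k < r.+1) noise_weight k * f k =
  q / r%:R * (\sum_(k < r) f k) + (1 - q) * f r.
Proof.
rewrite big_ord_recr/= {2}/noise_weight/= ltnn; congr (_ + _).
by rewrite mulr_sumr; apply: eq_bigr => k _; rewrite /noise_weight/= ltn_ord.
Qed.

Let r_neq0 : r%:R != 0 :> R. Proof. by rewrite pnatr_eq0 -lt0n. Qed.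

Lemma sum_noise_weight1 : \sum_k noise_weight k = 1.
Proof.
have := sum_noise_weight (fun=> 1); under eq_bigr do rewrite mulr1.
by move=> ->; rewrite sumr_const card_ord mulr1 -mulr_natr mul1r divfK// addrC subrK.
Qed.

Lemma measurable_secret k : measurable_fun setT (fun F : smooth_fun => secret F k).
Proof.
apply: measurable_maxr => //; apply: measurable_minr => //.
have m0 : measurable_fun setT (fun F : smooth_fun => (F, 0 : 'M[R]_(m, n))).
  exact: measurable_fun_pair.
exact: (measurableT_comp (measurable_entry _ _) (measurableT_comp measurable_gradient m0)).
Qed.

Lemma secret_le F k : `|secret F k| <= c.
Proof.
by rewrite ler_norml /secret le_max lexx ge_max ge_min lexx !orTb !andbT (le_trans _ c_ge0)// oppr_le0.
Qed.

Lemma measurable_revealing_grad : measurable_fun setT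
  (fun z : smooth_fun * 'M[R]_(m, n) * nat => revealing_grad z.1.1 z.1.2 z.2).
Proof.
have mF : measurable_fun setT (fun z : smooth_fun * 'M[R]_(m, n) * nat => z.1.1).
  exact: (measurableT_comp measurable_fst measurable_fst).
apply: measurable_matrixP => i j.
apply: (@eq_measurable_fun _ _ _ _ setT (fun z : smooth_fun * 'M[R]_(m, n) * nat =>
    gradient z.1.1 z.1.2 i j +
    (diag_rect (fun k => revealed z.1.1 z.2 k - secret z.1.1 k) : 'M[R]_(m, n)) i j)).
  by move=> z _; rewrite [RHS]mxE.
apply: measurable_funD.
  exact: (measurableT_comp (measurable_entry i j)
    (measurableT_comp measurable_gradient measurable_fst)).
apply: (measurableT_comp (measurable_entry i j)).
apply: measurable_diag_rect => k; apply: measurable_funB; last first.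
  exact: (measurableT_comp (measurable_secret k) mF).
apply: measurable_fun_ifT => //.
  apply: (measurableT_comp (f := fun xi : nat => xi == k) (g := snd)) => //.
by apply: measurable_funM => //; exact: (measurableT_comp (measurable_secret k) mF).
Qed.

Lemma revealing_grad_unbiased F x i j :
  \sum_k noise_weight k * revealing_grad F x k i j = gradient F x i j.
Proof.
have E k : revealing_grad F x k i j = gradient F x i j +
    \sum_l (revealed F k l - secret F l) * ((i == diag_row l) && (j == diag_col l))%:R.
  by rewrite mxE diag_rectE.
under eq_bigr do rewrite E mulrDr.
rewrite big_split/= -mulr_suml sum_noise_weight1 mul1r -[RHS]addr0; congr (_ + _).
under eq_bigr do rewrite mulr_sumr.
rewrite exchange_big big1//= => l _.
under eq_bigr do rewrite mulrA.
rewrite -mulr_suml (sum_noise_weight (fun k => revealed F k l - secret F l)).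
rewrite sumrB sumr_const card_ord (bigD1 l)//= {1}/revealed eqxx big1; last first.
  by move=> k kl; rewrite /revealed (negbTE (_ : _ != _)).
rewrite /revealed gtn_eqF// sub0r addr0 -[secret F l *+ r]mulr_natr.
have q0 : q != 0 by rewrite gt_eqF.
have cancel_s s : q / r%:R * (r%:R / q * s - s * r%:R) + (1 - q) * (- s) = 0.
  by field; rewrite r_neq0 q0.
by rewrite cancel_s mul0r.
Qed.

Lemma nuclear_norm_noise F x (xi : nat) :
  nuclear_norm (revealing_grad F x xi - gradient F x) <=
  (if (xi < r)%N then r%:R * c / q else 0) + r%:R * c.
Proof.
rewrite /revealing_grad addrC addKr nuclear_norm_diag_rect.
apply: (@le_trans _ _ (\sum_(k < r) (`|revealed F xi k| + `|secret F k|))).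
  by apply: ler_sum => k _; exact: ler_normB.
rewrite big_split/= lerD//; last first.
  apply: (@le_trans _ _ (\sum_(k < r) c)); first by apply: ler_sum => k _; exact: secret_le.
  by rewrite sumr_const card_ord mulr_natl.
have [xir|rxi] := ltnP xi r.
  rewrite (bigD1 (Ordinal xir))//= big1 ?addr0; last first.
    by move=> k kxi; rewrite /revealed (negbTE (_ : _ != _)) ?normr0// eq_sym.
  rewrite /revealed eqxx normrM ger0_norm ?divr_ge0 ?(ltW q_gt0)//.
  rewrite [leRHS]mulrAC ler_wpM2l ?divr_ge0 ?(ltW q_gt0)//.
  exact: secret_le.
rewrite big1// => k _; rewrite /revealed (negbTE (_ : _ != _)) ?normr0//.
by rewrite gtn_eqF// (leq_trans _ rxi).
Qed.

(** The noise has nuclear norm at most r c / q + r c with total probability q,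
    when a coordinate is revealed, and at most r c otherwise. *)
Lemma revealing_grad_moment (p sigma : R) F x : 1 < p ->
  q * (r%:R * c / q + r%:R * c) `^ p + (1 - q) * (r%:R * c) `^ p <= sigma `^ p ->
  \sum_k noise_weight k * nuclear_norm (revealing_grad F x k - gradient F x) `^ p
  <= sigma `^ p.
Proof.
move=> p1; apply: le_trans.
pose b (k : nat) := ((if (k < r)%N then r%:R * c / q else 0) + r%:R * c) `^ p.
apply: (@le_trans _ _ (\sum_(k < r.+1) noise_weight k * b k)).
  apply: ler_sum => k _; apply: ler_wpM2l; first exact: noise_weight_ge0.
  apply: ge0_ler_powR; rewrite ?nnegrE; last exact: nuclear_norm_noise.
  - by rewrite ltW// (lt_trans _ p1).
  - by apply: sumr_ge0 => i _; exact: sqrtr_ge0.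
  - by rewrite addr_ge0// ?mulr_ge0//; case: ifP => // _; rewrite divr_ge0 ?mulr_ge0// ltW.
rewrite sum_noise_weight /b ltnn add0r lerD2r.
rewrite (eq_bigr (fun=> (r%:R * c / q + r%:R * c) `^ p)); last first.
  by move=> k _; rewrite ltn_ord.
by rewrite sumr_const card_ord -[X in _ * X <= _]mulr_natl mulrA divfK.
Qed.

End revealing_oracle.

(** * Measurability of a run, and independent noise *)

(** Tonelli's theorem is applied to the measurable minorant g, with f the nuclear
    norm of the gradient at the iterate. *)
Lemma expectation_prod_ge d1 d2 (T1 : measurableType d1) (T2 : measurableType d2)
    (R : realType) (P1 : probability T1 R) (P2 : probability T2 R) (g f : T1 * T2 -> R) :
  measurable_fun setT g -> (forall z, 0 <= g z) -> (forall z, g z <= f z) ->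
  (\int[P2]_y \int[P1]_x (g (x, y))%:E <= 'E_(P1 \x P2)[f])%E.
Proof.
move=> mg g0 gf; rewrite expectation.unlock.
apply: (@le_trans _ _ (\int[(P1 \x P2)%E]_z (g z)%:E)%E); last first.
  by apply: le_integral_ge0 => z; rewrite lee_fin.
have mgE : measurable_fun setT (fun z => (g z)%:E) by exact/measurable_EFinP.
by rewrite (fubini_tonelli2 _ mgE)// => z; rewrite lee_fin.
Qed.

Section run_measurability.
Context {R : realType} {m n : nat} {Delta1 L : {posnum R}} {p sigma : R}.
Variables (O : oracle m n Delta1 L p sigma) (A : algorithm R m n) (k : nat).
Local Notation smooth_fun := (smooth_fun m n Delta1 L).
Local Notation sample := (smooth_fun * (seed_space A * k.-tuple (noise_space O)))%type.

Let measurable_seed : measurable_fun setT (fun w : sample => w.2.1).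
Proof. exact: (measurableT_comp measurable_fst measurable_snd). Qed.

Let measurable_query t (h : sample -> t.-tuple 'M[R]_(m, n)) :
  measurable_fun setT h -> measurable_fun setT (fun w => query (w.2.1, h w)).
Proof.
move=> mh; apply: (measurableT_comp (@query_measurable _ _ _ A t)).
exact: measurable_fun_pair.
Qed.

Lemma measurable_observations t : (t <= k)%N -> measurable_fun setT
  (fun w : sample => observations w.1 w.2.1 (nth point w.2.2) t).
Proof.
elim: t => [|t ih] tk /=; first exact: measurable_cst.
have mh := ih (ltnW tk).
(* The last entry of the tuple is the new gradient, the others are those of the
   previous tuple. *)
apply/measurable_fun_tnthP => i.
have [it|ti] := ltnP i t.
  apply: (@eq_measurable_fun _ _ _ _ setT (fun w : sample =>
    tnth (observations w.1 w.2.1 (nth point w.2.2) t) (Ordinal it))).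
    move=> w _ /=; rewrite (tnth_nth 0) [RHS](tnth_nth 0)/= nth_rcons size_tuple.
    by rewrite it.
  exact: (measurableT_comp (measurable_tnth (Ordinal it)) mh).
apply: (@eq_measurable_fun _ _ _ _ setT (fun w : sample =>
    oracle_grad w.1 (query (w.2.1, observations w.1 w.2.1 (nth point w.2.2) t))
      (tnth w.2.2 (Ordinal tk)))).
  move=> w _ /=; rewrite [RHS](tnth_nth 0)/= nth_rcons size_tuple.
  rewrite ltnNge ti/= eqn_leq ti -ltnS ltn_ord/=.
  by rewrite (tnth_nth point).
have mg : measurable_fun setT (fun w : sample =>
    ((w.1, query (w.2.1, observations w.1 w.2.1 (nth point w.2.2) t)),
     tnth w.2.2 (Ordinal tk))).
  apply: measurable_fun_pair.
    apply: measurable_fun_pair; first exact: measurable_fst.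
    exact: measurable_query.
  apply: (measurableT_comp (measurable_tnth (Ordinal tk))).
  exact: (measurableT_comp measurable_snd measurable_snd).
exact: (measurableT_comp (@oracle_measurable _ _ _ _ _ _ _ O) mg).
Qed.

Lemma measurable_gradient_iterate i j : measurable_fun setT
  (fun w : sample => gradient w.1 (iterate w.1 w.2.1 (nth point w.2.2) k.+1) i j).
Proof.
apply: (measurableT_comp (measurable_entry i j)).
have mx : measurable_fun setT (fun w : sample =>
    (w.1, iterate w.1 w.2.1 (nth point w.2.2) k.+1)).
  apply: measurable_fun_pair; first exact: measurable_fst.
  exact: (measurable_query (measurable_observations (leqnn k))).
exact: (measurableT_comp measurable_gradient mx).
Qed.

Lemma expected_stationarity_ge_average (I : finType) (w : I -> R) (F : I -> smooth_fun)
    (PF : probability smooth_fun R) : (forall s, 0 <= w s) -> finite_law w F PF ->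
  (\int[seed_law A \x iid (noise_law O) k]_y (\sum_s w s * \sum_i
     `|diag_entry (gradient (F s) (iterate (F s) y.1 (nth point y.2) k.+1)) i|)%:E
   <= expected_stationarity O PF A k.+1)%E.
Proof.
move=> w0 FP; pose g (v : sample) : R := \sum_i
  `|diag_entry (gradient v.1 (iterate v.1 v.2.1 (nth point v.2.2) k.+1)) i|.
have g_ge0 v : 0 <= g v by apply: sumr_ge0 => i _; exact: normr_ge0.
have mg : measurable_fun setT g.
  apply: measurable_sum => i; apply: (measurableT_comp (@normr_measurable R setT)).
  exact: measurable_gradient_iterate.
apply: le_trans (expectation_prod_ge PF (seed_law A \x iid (noise_law O) k)%E mg g_ge0 _).
  apply: le_integral_ge0 => y.
    rewrite lee_fin; apply: sumr_ge0 => s _; apply: mulr_ge0 => //; exact: (g_ge0 (F s, y)).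
  rewrite FP.
  - by rewrite le_eqVlt -sumEFin; apply/orP; left; apply/eqP/eq_bigr => s _; rewrite EFinM.
  - apply/measurable_EFinP.
    pose pair_y (G : smooth_fun) : sample := (G, y).
    have mpair : measurable_fun setT pair_y by exact: measurable_fun_pair.
    exact: (measurableT_comp mg mpair).
  - by move=> v; rewrite lee_fin g_ge0.
by move=> v; exact: sum_diag_le_nuclear_norm.
Qed.

End run_measurability.

Lemma measurable_tuple_forall d (T : measurableType d) (B : set T) (k : nat) :
  measurable B -> measurable [set v : k.-tuple T | forall j, B (tnth v j)].
Proof.
move=> mB.
rewrite (_ : [set _ | _] = \bigcap_(j in [set: 'I_k]) ((@tnth k T ^~ j) @^-1` B)).
  apply: fin_bigcap_measurable => // j _; rewrite -[X in measurable X]setTI.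
  exact: measurable_tnth.
by apply/seteqP; split=> v Bv j => [_|]; exact: Bv.
Qed.

Lemma iid_forall d (T : measurableType d) (R : realType) (P : probability T R)
    (B : set T) (b : R) (k : nat) : measurable B -> P B = b%:E ->
  iid P k [set v | forall j, B (tnth v j)] = (b ^+ k)%:E.
Proof.
move=> mB PB.
elim: k => [|k ih] /=.
  by rewrite diracE mem_set ?expr0// => -[].
rewrite /distribution /pushforward.
rewrite (_ : _ @^-1` _ = B `*` [set v : k.-tuple T | forall j, B (tnth v j)]).
  rewrite (product_measure1E P (iid P k) mB (measurable_tuple_forall mB)) exprS EFinM.
  by congr (_ * _)%E.
apply/seteqP; split=> -[x v] /= => [Bv|[Bx Bv] j].
  split; first exact: (Bv ord0).
  by move=> j; have := Bv (lift ord0 j); rewrite tnthS.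
case: (unliftP ord0 j) => [l ->|->]; last by [].
by rewrite tnthS.
Qed.

(** * The hard distribution *)

Section hard_instance.
Context {R : realType} {m n : nat} {Delta1 L : {posnum R}} {p sigma eps q : R}.
Local Notation r := (minn m n).
Local Notation smooth_fun := (smooth_fun m n Delta1 L).
Local Notation signs := {ffun 'I_r -> bool}.
Variable noise : probability nat R.
Hypotheses (r_gt0 : (0 < r)%N) (p_gt1 : 1 < p) (eps_gt0 : 0 < eps)
  (q_gt0 : 0 < q) (q_le1 : q <= 1)
  (noiseP : finite_law (@noise_weight R m n q) (@nat_of_ord r.+1) noise)
  (gap_le : 2 * eps ^+ 2 / L%:num <= Delta1%:num)
  (moment_le : q * (2 * eps / q + 2 * eps) `^ p + (1 - q) * (2 * eps) `^ p
               <= sigma `^ p).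

Let c := 2 * eps / r%:R.

Let r_neq0 : r%:R != 0 :> R. Proof. by rewrite pnatr_eq0 -lt0n. Qed.

Let c_gt0 : 0 < c. Proof. by rewrite divr_gt0 ?mulr_gt0 ?ltr0n. Qed.

Let rc : r%:R * c = 2 * eps. Proof. by rewrite mulrC divfK. Qed.

Let grad_integrable (F : smooth_fun) x i j :
  noise.-integrable setT (fun xi => (revealing_grad c q F x xi i j)%:E).
Proof. exact: (finite_law_integrable noiseP). Qed.

Let grad_unbiased (F : smooth_fun) x i j :
  ('E_noise[fun xi => revealing_grad c q F x xi i j] = (gradient F x i j)%:E)%E.
Proof.
rewrite expectation.unlock (finite_law_integral noiseP)//; congr EFin.
exact: revealing_grad_unbiased.
Qed.

Let grad_moment (F : smooth_fun) x :
  ('E_noise[fun xi => (nuclear_norm (revealing_grad c q F x xi - gradient F x) `^ p)%R]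
   <= (sigma `^ p)%:E)%E.
Proof.
rewrite expectation.unlock (finite_law_integral noiseP)// lee_fin.
by apply: revealing_grad_moment; rewrite ?rc// ltW.
Qed.

Definition revealing_oracle : oracle m n Delta1 L p sigma :=
  Oracle (measurable_revealing_grad c q) grad_integrable grad_unbiased grad_moment.

(** The offset 2 eps / L is the one for which a change of sign moves the
    derivative by 2 c, since (L / r) (2 eps / L) = c. *)
Definition hard_center (s : signs) (k : 'I_r) : R := (-1) ^+ s k * (2 * eps / L%:num).

Let hard_in_class s : in_class Delta1%:num L%:num
  (quadratic (m := m) (n := n) L%:num (hard_center s)).
Proof.
apply: in_class_quadratic => //; apply: le_trans gap_le.
under eq_bigr do rewrite exprMn sqrr_sign mul1r.
rewrite sumr_const card_ord -[X in _ * X <= _]mulr_natr.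
rewrite le_eqVlt; apply/orP; left; apply/eqP.
by field; rewrite r_neq0 gt_eqF.
Qed.

Definition hard_fun s : smooth_fun := SmoothFun (hard_in_class s).

Lemma gradient_hard_fun s x : gradient (hard_fun s) x =
  diag_rect (fun k => L%:num / r%:R * diag_entry x k - (-1) ^+ s k * c).
Proof.
rewrite gradient_quadratic//; congr diag_rect; apply/funext => k.
by rewrite mulrBr /hard_center /c; congr (_ - _); field; rewrite r_neq0 gt_eqF.
Qed.

Lemma secret_hard_fun s k : secret c (hard_fun s) k = - (-1) ^+ s k * c.
Proof.
rewrite /secret gradient_hard_fun diag_rectK /diag_entry mxE mulr0 sub0r.
have Nc_le : - c <= c by rewrite ge0_cp ?ltW.
case: (s k); rewrite ?expr0 ?expr1 ?opprK ?mulN1r ?mul1r ?opprK.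
  by rewrite minxx; exact/max_idPr.
by rewrite (min_idPr _) ?maxxx.
Qed.

(** The sign s k enters the answer only through coordinate k, and only when the
    noise is k. *)
Lemma revealing_grad_hard_fun s x xi : revealing_grad c q (hard_fun s) x xi =
  diag_rect (fun k => L%:num / r%:R * diag_entry x k
    + if xi == k then r%:R / q * (- (-1) ^+ s k * c) else 0).
Proof.
rewrite /revealing_grad gradient_hard_fun /diag_rect -big_split/=.
apply: eq_bigr => k _; rewrite -scalerDl; congr (_ *: _).
by rewrite /revealed secret_hard_fun !mulNr opprK [X in _ + X = _]addrC addrA subrK.
Qed.

Definition flip (i : 'I_r) (s : signs) : signs :=
  [ffun k => if k == i then ~~ s k else s k].

Lemma flipK i : involutive (flip i).
Proof.
by move=> s; apply/ffunP => k; rewrite !ffunE; case: eqP => // _; rewrite negbK.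
Qed.

(** Before coordinate i is revealed, no answer depends on s i; hence neither does
    the next query, by induction. *)
Lemma observations_flip (A : algorithm R m n) (s : signs) (i : 'I_r) rd (xi : nat -> nat) t :
  (forall u, (u < t)%N -> xi u != i) ->
  observations (O := revealing_oracle) (A := A) (hard_fun (flip i s)) rd xi t =
  observations (O := revealing_oracle) (A := A) (hard_fun s) rd xi t.
Proof.
elim: t => [//|t ih] xii /=; rewrite ih => [|u ut]; last first.
  by rewrite xii// ltnW.
apply/val_inj => /=; congr rcons.
rewrite !revealing_grad_hard_fun; congr diag_rect; apply/funext => k.
rewrite ffunE; case: eqP => // xk; case: eqVneq => // ki.
by have := xii t (ltnSn t); rewrite xk ki eqxx.
Qed.

Local Notation grad_diag A s rd xi T i := (diag_entry
  (gradient (hard_fun s) (iterate (O := revealing_oracle) (A := A) (hard_fun s) rd xi T)) i).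

(** The iterate is the same for s and flip i s, and the two derivatives at this
    point differ by 2 c in absolute value. *)
Lemma gradient_flip (A : algorithm R m n) (s : signs) (i : 'I_r) rd (xi : nat -> nat) T :
  (forall u, (u < T.-1)%N -> xi u != i) ->
  2 * c <= `|grad_diag A s rd xi T i| + `|grad_diag A (flip i s) rd xi T i|.
Proof.
move=> xii; rewrite {2}/iterate observations_flip// -/(iterate _ _ _ _).
rewrite !gradient_hard_fun !diag_rectK ffunE eqxx.
set u := _ * diag_entry _ _.
apply: le_trans (ler_normB _ _).
rewrite (_ : _ - _ = ((-1) ^+ (~~ s i) - (-1) ^+ s i) * c); last by ring.
rewrite normrM (gtr0_norm c_gt0) ler_wpM2r ?(ltW c_gt0)//.
by case: (s i); rewrite /= expr0 expr1 ?opprK -?opprD ?normrN ger0_norm.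
Qed.

(** Since flip i is a bijection of the sign vectors, twice the average over s is
    the average of the sums bounded in the previous lemma. *)
Lemma average_gradient (A : algorithm R m n) (i : 'I_r) rd (xi : nat -> nat) T :
  (forall u, (u < T.-1)%N -> xi u != i) ->
  c <= \sum_s #|{: signs}|%:R^-1 * `|grad_diag A s rd xi T i|.
Proof.
move=> xii.
have card_gt0 : 0 < #|{: signs}|%:R :> R.
  by rewrite ltr0n; apply/card_gt0P; exists [ffun=> true].
rewrite -mulr_sumr mulrC ler_pdivlMr//.
set S := (X in _ <= X).
suff : c * #|{: signs}|%:R *+ 2 <= S *+ 2 by rewrite lerMn2r.
rewrite [leRHS]mulr2n {2}/S (reindex_inj (inv_inj (flipK i)))/= /S -big_split/=.
apply: (@le_trans _ _ (\sum_(s : signs) 2 * c)).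
  by rewrite sumr_const -[leRHS]mulr_natr -mulrA mulr_natl.
by apply: ler_sum => s _; exact: gradient_flip.
Qed.

Lemma noise_misses (i : 'I_r) : noise [set xi : nat | xi != i] = (1 - q / r%:R)%:E.
Proof.
set S := [set xi : nat | xi != i].
have <- : (\int[noise]_xi (\1_S xi)%:E)%E = noise S by rewrite integral_indic// setIT.
rewrite (finite_law_integral noiseP)//; congr EFin.
have SE k : \1_S k = (k != i)%:R :> R.
  by rewrite indicE; congr (nat_of_bool _)%:R; apply/idP/idP; rewrite inE.
under eq_bigr do rewrite SE.
rewrite (sum_noise_weight _ (fun k : nat => (k != i)%:R)) gtn_eqF// mulr1.
rewrite (bigD1 i)//= eqxx add0r (eq_bigr (fun=> 1)); last first.
  by move=> k ki; rewrite (_ : nat_of_ord k != i).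
rewrite sumr_const cardC1 card_ord -subn1 natrB//.
by field; rewrite r_neq0.
Qed.

Variable hard : probability smooth_fun R.
Hypothesis hardP : finite_law (fun=> #|{: signs}|%:R^-1) hard_fun hard.

(** Each of the r coordinates contributes c on the event that the noise misses
    it, and r c = 2 eps. *)
Lemma expected_stationarity_ge (A : algorithm R m n) T : (0 < T)%N ->
  ((2 * eps * (1 - q / r%:R) ^+ T.-1)%:E
   <= expected_stationarity revealing_oracle hard A T)%E.
Proof.
case: T => // k _; rewrite [k.+1.-1]/=.
apply: le_trans (expected_stationarity_ge_average revealing_oracle A k _ hardP); last first.
  by move=> s; rewrite invr_ge0.
pose miss (i : 'I_r) : set (seed_space A * k.-tuple (noise_space revealing_oracle)) :=
  setT `*` [set v | forall j, [set xi : nat | xi != i] (tnth v j)].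
have miss_prob i : (seed_law A \x iid (noise_law revealing_oracle) k)%E (miss i)
    = ((1 - q / r%:R) ^+ k)%:E.
  rewrite /miss.
  rewrite (product_measure1E (seed_law A) (iid (noise_law revealing_oracle) k)) //.
    rewrite -[RHS]mul1e; congr (_ * _)%E; first exact: probability_setT.
    exact: (iid_forall (P := noise_law revealing_oracle) _ _ (noise_misses i)).
  exact: measurable_tuple_forall.
have miss_meas i : measurable (miss i).
  by apply: measurableX => //; exact: measurable_tuple_forall.
apply: le_trans; last first.
  apply: (@le_integral_ge0 _ _ R _ (fun y => (\sum_i c * \1_(miss i) y)%:E)) => [y|y].
    rewrite lee_fin; apply: sumr_ge0 => i _.
    by rewrite mulr_ge0 ?(ltW c_gt0)// indicE ler0n.
  rewrite lee_fin.
  under [leRHS]eq_bigr do rewrite mulr_sumr.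
  rewrite exchange_big/=; apply: ler_sum => i _.
  rewrite indicE; have [yi|_] := boolP (y \in miss i); last first.
    rewrite mulr0; apply: sumr_ge0 => s _; apply: mulr_ge0; last exact: normr_ge0.
    by rewrite invr_ge0.
  rewrite mulr1; apply: average_gradient => u uk.
  have [_ /= yu] := set_mem yi.
  by have := yu (Ordinal uk); rewrite (tnth_nth point).
rewrite (integral_sum_indic (ltW c_gt0) miss_meas miss_prob).
by rewrite lee_fin rc.
Qed.

End hard_instance.

(** * The lower bound *)

Lemma ler_bernoulli (R : realFieldType) (x : R) (k : nat) :
  0 <= x <= 1 -> 1 - k%:R * x <= (1 - x) ^+ k.
Proof.
move=> /andP[x0 x1]; elim: k => [|k ih]; first by rewrite mul0r subr0 expr0.
rewrite exprS; apply: le_trans (ler_wpM2l (_ : 0 <= 1 - x) ih); last by rewrite subr_ge0.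
have k0 : 0 <= k%:R :> R by [].
rewrite -natr1; nra.
Qed.

Lemma half_lt_expr_onem (R : realFieldType) (x : R) (T : nat) :
  0 <= x <= 1 -> T%:R * x < 1 / 2 -> 1 / 2 < (1 - x) ^+ T.-1.
Proof.
move=> x01 Tx; have := ler_bernoulli T.-1 x01.
have : T.-1%:R * x <= T%:R * x.
  by apply: ler_wpM2r; [case/andP: x01 | rewrite ler_nat leq_pred].
by set y := _ ^+ _; lra.
Qed.

(** After division by e^p, and with Q = q^(1 - p) >= 1, the left-hand side is
    Q (1 + q)^p + (1 - q). The first term is at most Q (1 + q) 2^(p - 1) because
    1 + q <= 2, the second one at most Q (1 - q) 2^(p - 1), and these bounds add
    up to 2^p Q. *)
Lemma noise_moment_le (R : realType) (p q e : R) : 1 < p -> 0 < q -> q <= 1 -> 0 < e ->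
  q * (e / q + e) `^ p + (1 - q) * e `^ p <= (2 * e) `^ p * q^-1 `^ (p - 1).
Proof.
move=> p1 q0 q1 e0; have p0 : 0 < p - 1 by rewrite subr_gt0.
have powRpred (x : R) : 0 < x -> x `^ p = x * x `^ (p - 1).
  move=> x0; rewrite -{2}[x]powRr1 ?ltW// -powRD; last by rewrite lt0r_neq0// implybT.
  by congr powR; ring.
have [q'0 e'0 q10] : [/\ 0 <= q^-1, 0 <= e & 0 <= 1 + q].
  by split; rewrite ?invr_ge0 ?addr_ge0// ltW.
have -> : e / q + e = e * (q^-1 * (1 + q)) by field; rewrite gt_eqF.
rewrite !powRM ?mulr_ge0// [q^-1 `^ p]powRpred ?invr_gt0//.
have q1_gt0 : 0 < 1 + q by rewrite addr_gt0.
rewrite [(1 + q) `^ p]powRpred// [2 `^ p]powRpred//.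
set Q := q^-1 `^ (p - 1); set t := 2 `^ (p - 1); set y := (1 + q) `^ (p - 1).
have Q1 : 1 <= Q.
  by rewrite -[leLHS](powRr0 q^-1) ler_powR ?(ltW p0)// invf_ge1.
have t1 : 1 <= t by rewrite -[leLHS](powRr0 2) ler_powR ?(ltW p0)// ler1n.
have yt : y <= t.
  apply: ge0_ler_powR; rewrite ?nnegrE//; first exact: ltW.
  lra.
have E0 : 0 <= e `^ p by exact: powR_ge0.
rewrite (_ : _ + _ = e `^ p * (Q * ((1 + q) * y) + (1 - q))); last first.
  by field; rewrite gt_eqF.
rewrite (_ : _ * Q = e `^ p * (Q * ((1 + q) * t) + (1 - q) * (t * Q))); last by ring.
apply: ler_wpM2l => //; apply: lerD.
  apply: ler_wpM2l; first exact: le_trans Q1.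
  exact: ler_wpM2l.
rewrite -[leLHS]mulr1 ler_wpM2l ?subr_ge0//.
by rewrite -[leLHS]mulr1 ler_pM.
Qed.

Unset Implicit Arguments.

Theorem mainTheorem4 (R : realType) (Delta1 L sigma : {posnum R}) (p eps : R)
    (hp1 : 1 < p) (hp2 : p <= 2) (heps0 : 0 < eps)
    (heps : eps < Num.min (sigma%:num / 4) (Num.sqrt (Delta1%:num * L%:num) / 2))
    (m n : nat) (hm : (2 <= m)%N) (hn : (2 <= n)%N) :
  (((minn m n)%:R / 2 * (sigma%:num / (4 * eps)) `^ (p / (p - 1)))%:E
   <= complexity m n eps Delta1 L p sigma%:num)%E.
Proof.
have r_gt0 : (0 < minn m n)%N by rewrite leq_min (ltnW hm) (ltnW hn).
have r0 : 0 < (minn m n)%:R :> R by rewrite ltr0n.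
move: heps; rewrite lt_min => /andP[eps_sigma eps_Delta].
(* With this q the right-hand side of noise_moment_le for e = 2 eps is
   (4 eps)^p u^p = sigma^p. *)
set u := sigma%:num / (4 * eps); set q' := u `^ (p / (p - 1)); set q := q'^-1.
have p10 : 0 < p - 1 by rewrite subr_gt0.
have eps40 : 0 < 4 * eps by rewrite mulr_gt0.
have u1 : 1 <= u by rewrite ler_pdivlMr// mul1r ltW// mulrC -ltr_pdivlMr.
have q'1 : 1 <= q'.
  by rewrite -[leLHS](powRr0 u) ler_powR// divr_ge0// ltW// (lt_trans _ hp1).
have q'0 : 0 < q' by exact: lt_le_trans q'1.
have q0 : 0 < q by rewrite invr_gt0.
have q1 : q <= 1 by rewrite invf_le1.
have gap : 2 * eps ^+ 2 / L%:num <= Delta1%:num.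
  rewrite ler_pdivrMr//.
  have : (2 * eps) ^+ 2 <= Delta1%:num * L%:num.
    rewrite -[leRHS]sqr_sqrtr ?mulr_ge0// ler_pXn2r ?nnegrE ?sqrtr_ge0 ?mulr_ge0 ?(ltW heps0)//.
    by rewrite mulrC -ler_pdivlMr// ltW.
  apply: le_trans; nra.
have moment : q * (2 * eps / q + 2 * eps) `^ p + (1 - q) * (2 * eps) `^ p
    <= sigma%:num `^ p.
  apply: le_trans (noise_moment_le hp1 q0 q1 _) _; first by rewrite mulr_gt0.
  rewrite /q invrK /q' -powRrM divfK ?gt_eqF//.
  rewrite -powRM ?(le_trans _ u1)//; last by rewrite !mulr_ge0// ltW.
  rewrite le_eqVlt; apply/orP; left; apply/eqP; congr powR.
  by rewrite /u; field; rewrite gt_eqF.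
have [noise noiseP] := finite_law_exists ord0 (@nat_of_ord (minn m n).+1)
  (noise_weight_ge0 q0 q1) (sum_noise_weight1 _ r_gt0).
have card_gt0 : (0 < #|{: {ffun 'I_(minn m n) -> bool}}|)%N.
  by apply/card_gt0P; exists [ffun=> true].
have sign_weight0 (s : {ffun 'I_(minn m n) -> bool}) :
    0 <= #|{: {ffun 'I_(minn m n) -> bool}}|%:R^-1 :> R by rewrite invr_ge0.
have sign_weight1 : \sum_(s : {ffun 'I_(minn m n) -> bool})
    #|{: {ffun 'I_(minn m n) -> bool}}|%:R^-1 = 1 :> R.
  by rewrite sumr_const -[LHS]mulr_natr mulVf// pnatr_eq0 -lt0n.
have [hard hardP] := finite_law_exists [ffun=> true] (hard_fun r_gt0 gap)
  sign_weight0 sign_weight1.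
pose O : oracle m n Delta1 L p sigma%:num :=
  revealing_oracle r_gt0 hp1 heps0 q0 q1 noiseP moment.
(* The suprema are bounded below by the values at this oracle and this
   distribution. *)
apply: (@le_trans _ _ (ereal_inf [set v | exists A : algorithm R m n,
    v = hitting_time eps O hard A])); last first.
  apply: (@le_trans _ _ (ereal_sup [set w | exists PF, w =
      ereal_inf [set v | exists A : algorithm R m n, v = hitting_time eps O PF A]])).
    by apply: ereal_sup_ubound; exists hard.
  by apply: ereal_sup_ubound; exists O.
apply/ereal_infP => _ [A ->]; apply/ereal_infP => _ [T [T_gt0 ET] <-].
rewrite lee_fin leNgt; apply/negP => T_lt.
have := le_trans (@expected_stationarity_ge _ _ _ _ _ _ _ _ _ _ r_gt0 hp1 heps0 q0 q1
  noiseP gap moment _ hardP A T T_gt0) ET.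
rewrite lee_fin leNgt => /negP; apply.
set x := q / (minn m n)%:R.
have x01 : 0 <= x <= 1.
  rewrite divr_ge0 ?(ltW q0)//= ler_pdivrMr// mul1r (le_trans q1)//.
  by rewrite ler1n.
have Tx : T%:R * x < 1 / 2.
  rewrite /x mulrA ltr_pdivrMr// -ltr_pdivlMr//.
  by rewrite /q invrK div1r [2^-1 * _]mulrC.
have y2 := half_lt_expr_onem x01 Tx.
by rewrite mulrAC -[ltLHS]mul1r ltr_pM2r// mulrC -ltr_pdivrMr.
Qed.
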